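(* Let $\mathcal{A}=\langle A,R\rangle$ be an almost bounded structure with $|A|=\lambda$, and let $\mathcal{A}^*$ be an ultrapower of $\mathcal{A}$ modulo an ultrafilter that is (at least) $2^\lambda$-regular. Then $\mathcal{A}\preceq\mathcal{A}^{\mathfrak{ue}}\preceq\mathcal{A}^*$.
   Context: All structures are of the form $\mathcal{A}=\langle A,R\rangle$ with a single binary relation $R\subseteq A\times A$. $\mathcal{A}$ is bounded if there is a finite number that bounds the in-degree and out-degree of every node of $\mathcal{A}$. $\mathcal{A}$ is almost bounded if, except for finitely many nodes with infinite degree (infinitely many $R$-successors or infinitely many $R$-predecessors), $\mathcal{A}$ is bounded; i.e. only finitely many nodes have infinite degree and there is a finite bound on the in- and out-degrees of all the other nodes. The ultrafilter extension of $\mathcal{A}$ is $\mathcal{A}^{\mathfrak{ue}}=\langle \mathrm{Uf}(A),R^{\mathfrak{ue}}\rangle$, where $\mathrm{Uf}(A)$ is the set of all ultrafilters over $A$ and $R^{\mathfrak{ue}}(u,v)$ holds iff $\{R[X]:X\in u\}\subseteq v$ (equivalently $\{\langle R\rangle(X):X\in v\}\subseteq u$), with $R[X]=\{s:(\exists w\in X)\,R(w,s)\}$ and $\langle R\rangle(X)=\{w:(\exists s\in X)\,R(w,s)\}$. $\mathcal{A}$ is regarded as a substructure of $\mathcal{A}^{\mathfrak{ue}}$ through $w\mapsto\pi_w=\{X\subseteq A:w\in X\}$. $\mathcal{A}^{\mathfrak{ue}}\preceq\mathcal{A}^*$ means that $\mathcal{A}^{\mathfrak{ue}}$ is, up to an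 embedding, an elementary substructure of $\mathcal{A}^*$ (there is an elementary embedding of $\mathcal{A}^{\mathfrak{ue}}$ into $\mathcal{A}^*$). An ultrafilter $\mathcal{D}$ over an infinite set $I$ is $\kappa$-regular if there is $E\subseteq\mathcal{D}$ with $|E|=\kappa$ such that each $i\in I$ belongs to only finitely many members of $E$. *)

(* Defs.v *)
From mathcomp Require Import all_boot.
From mathcomp Require Import generic_quotient.
From mathcomp Require Import boolp classical_sets functions cardinality filter.

Set Implicit Arguments.
Unset Strict Implicit.
Unset Printing Implicit Defensive.

Local Open Scope classical_set_scope.
Local Open Scope card_scope.
Local Open Scope quotient_scope.

Record structure := Structure {
  carrier :> Type;
  edge : carrier -> carrier -> Prop
}.

(* [formula n] has its free variables among [0, ..., n-1]. Under [All] the bound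
   variable is index 0 and the free ones are shifted (de Bruijn). Scoping by [n]
   makes the valuations of a sentence exist on an empty domain too. The other
   connectives and the existential quantifier are classically definable. *)
Inductive formula : nat -> Type :=
| Eq n of 'I_n & 'I_n : formula n
| Rel n of 'I_n & 'I_n : formula n
| Bot n : formula n
| Imp n of formula n & formula n : formula n
| All n of formula n.+1 : formula n.

Definition extend (M : Type) n (a : M) (e : 'I_n -> M) : 'I_n.+1 -> M :=
  fun i => if unlift ord0 i is Some j then e j else a.

Fixpoint sat (M : structure) n (phi : formula n) : ('I_n -> M) -> Prop :=
  match phi in formula n return ('I_n -> M) -> Prop with
  | Eq _ i j => fun e => e i = e j
  | Rel _ i j => fun e => edge (e i) (e j)
  | Bot _ => fun=> False
  | Imp _ phi psi => fun e => sat phi e -> sat psi e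
  | All _ phi => fun e => forall a : M, sat phi (extend a e)
  end.

Definition elementary_embedding (M N : structure) (h : M -> N) : Prop :=
  forall n (phi : formula n) (e : 'I_n -> M), sat phi e <-> sat phi (h \o e).

Definition successors (M : structure) (w : M) : set M := [set s | edge w s].
Definition predecessors (M : structure) (w : M) : set M := [set s | edge s w].

Definition infinite_degree (M : structure) (w : M) : Prop :=
  infinite_set (successors w) \/ infinite_set (predecessors w).

Definition almost_bounded (M : structure) : Prop :=
  finite_set [set w : M | infinite_degree w] /\
  exists n : nat, forall w : M, ~ infinite_degree w ->
    successors w #<= `I_n /\ predecessors w #<= `I_n.

Definition Uf (T : Type) : Type := {u : set_system T | UltraFilter u}.

#[global] Instance Uf_ultra T (u : Uf T) : UltraFilter (sval u) := proj2_sig u.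

Definition image_rel {M : structure} (X : set M) : set M :=
  [set s | exists2 w, X w & edge w s].

Definition ue (M : structure) : structure :=
  Structure (fun u v : Uf M => image_rel @` sval u `<=` sval v).

(* [principal_filter w] is the set of all [X] such that [X w], by
   [principal_filterP]. *)
Definition principal (M : structure) (w : M) : ue M :=
  exist _ (principal_filter w) (principal_filter_ultra w).

Section Ultrapower.
Variables (I : Type) (D : Uf I) (M : structure).

Definition eq_mod (f g : {classic I -> M}) : bool :=
  `[< sval D [set i | f i = g i] >].

Lemma eq_mod_refl : reflexive eq_mod.
Proof.
move=> f; apply/asboolP.
by apply: (filterS _ filterT) => i _.
Qed.

Lemma eq_mod_sym : symmetric eq_mod.
Proof.
move=> f g; apply: asbool_equiv_eq.
by split; apply: filterS => i /= ->.
Qed.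

Lemma eq_mod_trans : transitive eq_mod.
Proof.
move=> g f h /asboolP fg /asboolP gh; apply/asboolP.
by apply: filterS2 fg gh => i /= -> ->.
Qed.

Canonical eq_mod_equiv := EquivRel eq_mod eq_mod_refl eq_mod_sym eq_mod_trans.

(* Since [D] is a filter, the choice of representatives is irrelevant. *)
Definition ultrapower : structure :=
  Structure (fun x y : {eq_quot eq_mod_equiv} =>
    sval D [set i | edge ((repr x : I -> M) i) ((repr y : I -> M) i)]).

End Ultrapower.

(* The cardinal kappa is that of the type [K]. *)
Definition regular_ultrafilter (K I : Type) (D : Uf I) : Prop :=
  exists E : set (set I),
    [/\ E `<=` sval D, E #= [set: K] &
        forall i : I, finite_set [set X | E X /\ X i]].

(* Main.v *)
Require Import Defs.
From mathcomp Require Import all_boot.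
From mathcomp Require Import generic_quotient.
From mathcomp Require Import boolp classical_sets functions cardinality filter.

Set Implicit Arguments.
Unset Strict Implicit.
Unset Printing Implicit Defensive.

Local Open Scope classical_set_scope.
Local Open Scope card_scope.
Local Open Scope quotient_scope.

(** Write [A*] for the ultrapower. Every element [x] of [A*] has a type over
    [A], the ultrafilter of those [X] whose extension to [A*] contains [x]. By
    regularity every ultrafilter on [A] is such a type ([regular_realizes]);
    the task is to choose realizations [h u] simultaneously, compatibly with
    the edges, and so that [h] is elementary.

    Almost boundedness enters only through [almost_bounded_tame]: the edge
    relation is a finite union of partial injections and of rectangles.
    Rectangles are harmless, since whether they hold at [x, y] depends on the
    types of [x] and [y] alone. For partial injections the point is Katetov's
    theorem ([fixed_points_ultra]): if [g] maps an ultrafilter to itself, it is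
    the identity on a set of that ultrafilter. Call two elements of [A*] linked
    when the extension of some partial injection of [A] maps one to the other.
    By Katetov's theorem the type map is injective on each class of linked
    elements ([linked_type_inj]), and such a class is mapped onto a class of
    the ultrafilter extension. Hence one can realize one ultrafilter in each
    class and propagate: this gives a section [h] of the type map whose image
    is closed under linking ([coherent_section_exists]), and [h] preserves and
    reflects all tame relations, in particular the edges
    ([coherent_section_star]).

    That [h] is elementary follows from a Tarski-Vaught argument
    ([coherent_section_witness]). Suppose [phi(x, p)], with parameters [p] in
    the image of [h], holds for all [x] in that image but fails at some [b].
    Let [u] be the type of [b], and pass to the ultrapower of [A*] modulo [u],
    with index set [A]. The class [b'] of the function sending [w] to the
    realization of the principal ultrafilter at [w] has type [u] and satisfies
    [phi], while the diagonal image of [b] has type [u] and does not. Neither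
    is linked to a parameter, so exchanging the linking classes of [b] and [b']
    through their common types is an automorphism that fixes the parameters
    and moves [b] to [b']: a contradiction ([sat_swap]).

    Finally [h] maps the principal ultrafilters to the diagonal of [A*]. The
    diagonal embedding of [A] is elementary by Los's theorem, so the principal
    embedding is elementary as well. *)

(** * Finite sets and ultrafilters *)

Lemma finite_set_induction (T : Type) (P : set T -> Prop) :
  P set0 -> (forall x B, P B -> P (x |` B)) ->
  forall B, finite_set B -> P B.
Proof.
move=> P0 PU B finB.
have [s ->] : exists s : seq {classic T}, B = [set` s] by exact/finite_seqP.
elim: s => [|x s IH]; first by rewrite set_nil.
rewrite (_ : [set` x :: s] = x |` [set` s]); first exact: PU.
by apply/seteqP; split=> y /=; rewrite inE => /predU1P.
Qed.

Section Ultrafilters.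
Variables (T : Type) (u : Uf T).

Lemma uf_meet X Y : sval u X -> sval u Y -> exists x, X x /\ Y x.
Proof. by move=> uX /(filterI uX)/filter_ex. Qed.

Lemma uf_setC X : sval u (~` X) <-> ~ sval u X.
Proof.
split=> [uNX uX|nuX]; last by case: (in_ultra_setVsetC X (Uf_ultra u)).
by have [x []] := uf_meet uX uNX.
Qed.

Lemma uf_bigcap (F : set (set T)) :
  finite_set F -> F `<=` sval u -> sval u (\bigcap_(X in F) X).
Proof.
move: F; apply: finite_set_induction => [_|X F IH Fu].
  by rewrite bigcap_set0; exact: filterT.
rewrite bigcap_setU1; apply: filterI; first by apply: Fu; left.
by apply: IH => Y FY; apply: Fu; right.
Qed.

Lemma uf_ext (v : Uf T) : sval u `<=` sval v -> u = v.
Proof.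
case: u v => [U ultraU] [V ultraV] /= UV; apply: eq_exist.
by rewrite (max_filter (UltraFilter := ultraU) _ UV).
Qed.

End Ultrafilters.

(** * Lifting relations to ultrafilters *)

(** The edge relation of the ultrafilter extension, in a form that makes sense
    for every relation and is visibly symmetric under converse. *)
Definition ue_lift (A : Type) (S : A -> A -> Prop) (u v : Uf A) : Prop :=
  forall X Y, sval u X -> sval v Y -> exists x y, [/\ X x, Y y & S x y].

Lemma edge_ue (A : structure) (u v : ue A) :
  edge u v <-> ue_lift (@edge A) u v.
Proof.
split=> [uv X Y uX vY|uv _ [X uX <-]].
  have /(uf_meet vY)[y [Yy [x Xx xy]]] : sval v (image_rel X).
    by apply: uv; exists X.
  by exists x, y.
case: (in_ultra_setVsetC (image_rel X) (Uf_ultra v)) => // vN.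
have [x [y [Xx nXy xy]]] := uv _ _ uX vN.
by case: nXy; exists x.
Qed.

Section UeLift.
Variable A : Type.
Implicit Types (S : A -> A -> Prop) (u v w : Uf A).

Lemma ue_lift_eq u : ue_lift eq u u.
Proof.
by move=> X Y uX uY; have [x [Xx Yx]] := uf_meet uX uY; exists x, x.
Qed.

Lemma ue_lift_conv S u v : ue_lift S u v -> ue_lift (fun a b => S b a) v u.
Proof.
by move=> uv X Y vX uY; have [y [x []]] := uv _ _ uY vX; exists x, y.
Qed.

Lemma ue_lift_comp S S' u v w : ue_lift S u v -> ue_lift S' v w ->
  ue_lift (fun a c => exists2 b, S a b & S' b c) u w.
Proof.
move=> uv vw X Z uX wZ.
pose Y : set A := [set y | exists2 x, X x & S x y].
have vY : sval v Y.
  case: (in_ultra_setVsetC Y (Uf_ultra v)) => // vN.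
  have [x [y [Xx nYy xy]]] := uv _ _ uX vN.
  by case: nYy; exists x.
have [y [z [[x Xx xy] Zz yz]]] := vw _ _ vY wZ.
by exists x, z; split=> //; exists y.
Qed.

Lemma ue_liftU S S' u v : ue_lift (fun a b => S a b \/ S' a b) u v ->
  ue_lift S u v \/ ue_lift S' u v.
Proof.
move=> uv; apply: contrapT => /not_orP[].
move=> /existsNP[X /existsNP[Y]] /not_implyP[uX /not_implyP[vY nS]].
move=> /existsNP[X' /existsNP[Y']] /not_implyP[uX' /not_implyP[vY' nS']].
have [x [y [[Xx Xx'] [Yy Yy'] [Sxy|Sxy]]]] :=
  uv _ _ (filterI uX uX') (filterI vY vY').
- by apply: nS; exists x, y.
- by apply: nS'; exists x, y.
Qed.

Lemma ue_lift_rect (X Y : set A) u v :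
  ue_lift (fun a b => X a /\ Y b) u v -> sval u X /\ sval v Y.
Proof.
move=> uv; split.
- case: (in_ultra_setVsetC X (Uf_ultra u)) => // uN.
  by have [x [y [nX _ [Xx _]]]] := uv _ _ uN filterT.
- case: (in_ultra_setVsetC Y (Uf_ultra v)) => // vN.
  by have [x [y [_ nY [_ Yy]]]] := uv _ _ filterT vN.
Qed.

End UeLift.

(** * Partial injections *)

Section PartialInjections.
Variable A : Type.
Implicit Types (g : A -> A -> Prop) (u v w : Uf A).

Definition partial_injection g : Prop :=
  (forall a b b', g a b -> g a b' -> b = b') /\
  (forall a a' b, g a b -> g a' b -> a = a').

Lemma partial_injection_eq : partial_injection eq.
Proof. by split=> [a b b' <-|a a' b ->]. Qed.

Lemma partial_injection_conv g :
  partial_injection g -> partial_injection (fun a b => g b a).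
Proof.
by move=> [gf gi]; split=> a b c ab ac; [exact: gi ab ac|exact: gf ab ac].
Qed.

Lemma partial_injection_comp g g' :
  partial_injection g -> partial_injection g' ->
  partial_injection (fun a c => exists2 b, g a b & g' b c).
Proof.
move=> [gf gi] [gf' gi']; split=> [a c c' [b ab bc] [b' ab' bc']|].
  by move: bc'; rewrite -(gf _ _ _ ab ab'); exact: gf'.
move=> a a' c [b ab bc] [b' ab' bc'].
by move: ab'; rewrite -(gi' _ _ _ bc bc'); exact: gi.
Qed.

(** A partial injection acts on ultrafilters as a partial function: if some
    [Y] separated [v] from [w], the points sent outside of [Y] would form a
    set both in [u] and avoided by [u]. *)
Lemma ue_lift_functional g u v w : partial_injection g ->
  ue_lift g u v -> ue_lift g u w -> v = w.
Proof.
move=> [gf _] uv uw; apply: uf_ext => Y vY.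
case: (in_ultra_setVsetC Y (Uf_ultra w)) => // wN.
pose X : set A := [set x | exists2 y, ~ Y y & g x y].
have uX : sval u X.
  case: (in_ultra_setVsetC X (Uf_ultra u)) => // uN.
  have [x [y [nXx nYy xy]]] := uw _ _ uN wN.
  by case: nXx; exists y.
have [x [y [[y' nYy' xy'] Yy xy]]] := uv _ _ uX vY.
by case: nYy'; rewrite (gf _ _ _ xy' xy).
Qed.

(** Zorn's lemma, applied to the sets that span no edge of [g]: by maximality,
    a point outside of [X] is a loop or a neighbour of [X]. *)
Lemma maximal_independent g : exists X : set A,
  (forall a b, X a -> X b -> ~ g a b) /\
  (forall x, ~ X x -> g x x \/ exists2 y, X y & g x y \/ g y x).
Proof.
pose P : set (set A) := [set X | forall a b, X a -> X b -> ~ g a b].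
have [|X [PX maxX]] := @Zorn_bigcup A P.
  move=> F FP Ftot a b [X FX Xa] [Y FY Yb].
  by case: (Ftot _ _ FX FY) => XY; [apply: (FP _ FY)|apply: (FP _ FX)] => //;
    exact: XY.
exists X; split=> // x nXx; apply: contrapT => /not_orP[nxx nXg].
apply: (maxX (x |` X)).
  by split=> [y Xy|/(_ x (or_introl erefl))//]; right.
move=> a b [->|Xa] [->|Xb] //; last exact: PX.
- by move=> xb; apply: nXg; exists b => //; left.
- by move=> ax; apply: nXg; exists a => //; right.
Qed.

(** Katetov's theorem for partial injections. For a maximal independent set
    [X], every point lies in [X], in its preimage, in its image, or is fixed.
    The ultrafilter [u] contains neither [X], since [g] has no edge from [X] to
    [X], nor its image or preimage, since [g] preserves [u] and the complement
    of [X] belongs to [u]. *)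
Lemma fixed_points_ultra g u : partial_injection g ->
  ue_lift g u u -> sval u [set x | g x x].
Proof.
move=> [gf gi] uu.
have [X [indX maxX]] := maximal_independent g.
have nuX : sval u (~` X).
  apply/uf_setC => uX; have [x [y [Xx Xy]]] := uu _ _ uX uX.
  exact: indX.
have out : sval u (~` [set x | exists2 y, X y & g x y]).
  apply/uf_setC => uZ; have [x [y [[y' Xy' xy'] nXy xy]]] := uu _ _ uZ nuX.
  by case: nXy; rewrite (gf _ _ _ xy xy').
have inn : sval u (~` [set x | exists2 y, X y & g y x]).
  apply/uf_setC => uZ; have [x [y [nXx [x' Xx' xy'] xy]]] := uu _ _ nuX uZ.
  by case: nXx; rewrite (gi _ _ _ xy xy').
apply: filterS (filterI nuX (filterI out inn)) => x [/maxX[//|[y Xy]]].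
by case=> xy [o i]; [case: o|case: i]; exists y.
Qed.

End PartialInjections.

(** * Tame relations *)

(** Finite unions of partial injections and rectangles, presented inductively
    because each use is an induction over the union. *)
Inductive tame (A : Type) : (A -> A -> Prop) -> Prop :=
| tame_injection g : partial_injection g -> tame g
| tame_rect (X Y : set A) : tame (fun a b => X a /\ Y b)
| tameU S S' : tame S -> tame S' -> tame (fun a b => S a b \/ S' a b).

Lemma eq_tame (A : Type) (S S' : A -> A -> Prop) :
  (forall a b, S a b <-> S' a b) -> tame S -> tame S'.
Proof.
by move=> SS'; rewrite (_ : S = S') //; apply/funext=> a; apply/funext=> b;
  apply/propext.
Qed.

Lemma tame_bigcup (A J : Type) (B : set J) (S : J -> A -> A -> Prop) :
  finite_set B -> (forall j, tame (S j)) ->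
  tame (fun a b => exists2 j, B j & S j a b).
Proof.
move=> finB tS; move: B finB; apply: finite_set_induction.
  apply: (eq_tame _ (tame_rect set0 set0)) => a b.
  by split=> [[]|[? []]].
move=> j B; apply: (fun t => eq_tame _ (tameU (tS j) t)) => a b; split.
  by case=> [?|[k ? ?]]; [exists j => //; left|exists k => //; right].
by case=> k [->|Bk] kab; [left|right; exists k].
Qed.

Lemma card_le_label (T : Type) (B : set T) n : B #<= `I_n ->
  exists f : T -> nat, (forall x, B x -> (f x < n)%N) /\
    forall x y, B x -> B y -> f x = f y -> x = y.
Proof.
move=> /pcard_leP/unsquash f; exists f; split.
  by move=> x Bx; exact: (@funS _ _ _ _ f).
by move=> x y Bx By; apply: inj; rewrite inE.
Qed.

(** Let [C] be the finite set of nodes of infinite degree. The edges at each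
    [c] in [C] form two rectangles, one from [c] and one to [c]. Outside of
    [C], number the edges leaving each node and those entering each node, with
    fewer than [n] labels: once both labels are prescribed, an edge is
    determined by either end. *)
Lemma almost_bounded_tame (A : structure) :
  almost_bounded A -> tame (@edge A).
Proof.
move=> [finC [n deg]].
pose C : set A := [set w | infinite_degree w].
have /choice[out outP] : forall w : A, exists f : A -> nat, ~ C w ->
    (forall x, edge w x -> (f x < n)%N) /\
    forall x y, edge w x -> edge w y -> f x = f y -> x = y.
  move=> w; have [?|nCw] := pselect (C w); first by exists (fun=> 0).
  by have [f fP] := card_le_label (deg w nCw).1; exists f.
have /choice[inn innP] : forall w : A, exists f : A -> nat, ~ C w ->
    (forall x, edge x w -> (f x < n)%N) /\
    forall x y, edge x w -> edge y w -> f x = f y -> x = y.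
  move=> w; have [?|nCw] := pselect (C w); first by exists (fun=> 0).
  by have [f fP] := card_le_label (deg w nCw).2; exists f.
pose colour p q (a b : A) :=
  [/\ edge a b, ~ C a, ~ C b & out a b = p /\ inn b a = q].
have colour_inj p q : partial_injection (colour p q).
  split=> [a b b' [ab na nb [<- _]] [ab' _ _ [o _]]|].
    by apply: (outP a na).2.
  move=> a a' b [ab na nb [_ <-]] [ab' _ _ [_ o]].
  by apply: (innP b nb).2.
have fI m : finite_set `I_m by [].
have finC' : finite_set C by exact: finC.
apply: (eq_tame _ (tameU (tame_bigcup (fI n) (fun p =>
    tame_bigcup (fI n) (fun q => tame_injection (colour_inj p q))))
  (tameU (tame_bigcup finC' (fun c => tame_rect [set c] [set b | edge c b]))
    (tame_bigcup finC' (fun c => tame_rect [set a | edge a c] [set c])))))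
  => a b; split.
  by case=> [[p _ [q _ []]]|[[c _ [-> ?]]|[c _ [? ->]]]].
move=> ab.
have [Ca|nCa] := pselect (C a); first by right; left; exists a.
have [Cb|nCb] := pselect (C b); first by right; right; exists b.
left; exists (out a b); first exact: (outP a nCa).1.
by exists (inn b a); first exact: (innP b nCb).1.
Qed.

(** * Extensions of the calculus of relations *)

(** What is needed of the elementary extension from [A] to an ultrapower, all
    relations on [A] being added to the language. The iterated ultrapower in
    the Tarski-Vaught argument is covered by the same axioms, and it is the
    preservation of composition that carries the witnesses of existential
    statements. *)
Record extension (A M : Type) := Extension {
  star : (A -> A -> Prop) -> M -> M -> Prop;
  starI : forall S S' x y,
    star (fun a b => S a b /\ S' a b) x y <-> star S x y /\ star S' x y;
  starN : forall S x y, star (fun a b => ~ S a b) x y <-> ~ star S x y;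
  star_eq : forall x y, star eq x y <-> x = y;
  star_conv : forall S x y, star (fun a b => S b a) x y <-> star S y x;
  star_comp : forall S S' x z,
    star (fun a c => exists2 b, S a b & S' b c) x z <->
    exists2 y, star S x y & star S' y z
}.

Section Extensions.
Variables (A M : Type) (E : extension A M).
Implicit Types (S g : A -> A -> Prop) (X Y : set A) (x y : M) (u v : Uf A).

Lemma eq_star S S' x y : (forall a b, S a b <-> S' a b) ->
  star E S x y <-> star E S' x y.
Proof.
by move=> SS'; rewrite (_ : S = S') //; apply/funext=> a; apply/funext=> b;
  apply/propext.
Qed.

Lemma star_sub S S' x y : (forall a b, S a b -> S' a b) ->
  star E S x y -> star E S' x y.
Proof.
move=> SS' xy; have /eq_star h a b : S a b <-> S a b /\ S' a b.
  by split=> [ab|[]//]; split=> //; exact: SS'.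
by have /starI[] := (h x y).1 xy.
Qed.

Lemma star0 x y : ~ star E (fun _ _ => False) x y.
Proof.
move=> xy; have : star E (fun _ _ => ~ False) x y by apply: star_sub xy.
by move/starN.
Qed.

Lemma starT x y : star E (fun _ _ => True) x y.
Proof.
have /starN : ~ star E (fun _ _ => False) x y by exact: star0.
by apply: star_sub.
Qed.

Lemma star_ex S x y : star E S x y -> exists a b, S a b.
Proof.
move=> xy; apply: contrapT => nS; apply: (@star0 x y).
by apply: star_sub xy => a b ab; apply: nS; exists a, b.
Qed.

Lemma starU S S' x y : star E (fun a b => S a b \/ S' a b) x y <->
  star E S x y \/ star E S' x y.
Proof.
split=> [xy|[]]; last 2 first.
- by apply: star_sub => a b; left.
- by apply: star_sub => a b; right.
apply: contrapT => /not_orP[/starN nS /starN nS'].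
have nSS' := (starI E _ _ x y).2 (conj nS nS').
have /star_ex[a [b [ab []]]] := (starI E _ _ x y).2 (conj xy nSS').
by case: ab.
Qed.

(** The rectangle [X * A] absorbs the full relation on its right. *)
Lemma star_row X x y z :
  star E (fun a _ => X a) x y -> star E (fun a _ => X a) x z.
Proof.
move=> xy; have : exists2 y, star E (fun a _ => X a) x y &
    star E (fun _ _ => True) y z.
  by exists y => //; exact: starT.
by move/star_comp; apply: star_sub => a b [].
Qed.

(** The relation [X * A] stands for the set [X]; by [star_row] its extension
    depends on the first coordinate only, so every pair [(x, y)] would give the
    same set. *)
Definition type_set x : set_system A := [set X | star E (fun a _ => X a) x x].

Lemma type_set_proper x : ProperFilter (type_set x).
Proof.
apply: Build_ProperFilter_ex.
  by move=> X /star_ex[a [_ Xa]]; exists a.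
split.
- exact: starT.
- by move=> X Y xX xY; apply/(starI E (fun a _ => X a) (fun a _ => Y a)).
- by move=> X Y XY; apply: star_sub => a _; exact: XY.
Qed.

Lemma type_set_ultra x : UltraFilter (type_set x).
Proof.
have xP := type_set_proper x; split=> // G PG xG.
rewrite eqEsubset; split => // X GX; apply: contrapT => /starN/(xG (~` X)) GN.
by move: GN => /(filterI GX)/filter_ex[a []].
Qed.

Definition type_of x : Uf A := exist _ (type_set x) (type_set_ultra x).

Lemma star_rect X Y x y : star E (fun a b => X a /\ Y b) x y <->
  sval (type_of x) X /\ sval (type_of y) Y.
Proof.
rewrite starI (star_conv E (fun b _ => Y b)).
by split=> -[xX yY]; split; apply: star_row;
  [exact: xX|exact: yY|exact: xX|exact: yY].
Qed.

Lemma star_ue_lift S x y : star E S x y -> ue_lift S (type_of x) (type_of y).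
Proof.
move=> xy X Y xX yY.
have XY : star E (fun a b => X a /\ Y b) x y by exact/star_rect.
by have /starI/star_ex[a [b [ab []]]] := conj xy XY; exists a, b.
Qed.

(** The domain of [g] belongs to the type of [x], so [x] has an image under
    [g], and the type of this image can only be [v]. *)
Lemma star_step g x v : partial_injection g -> ue_lift g (type_of x) v ->
  exists2 y, star E g x y & type_of y = v.
Proof.
move=> inj_g xv.
pose X : set A := [set a | exists b, g a b].
have xX : sval (type_of x) X.
  apply: contrapT => /uf_setC nX.
  have [a [b [nXa _ ab]]] := xv _ _ nX filterT.
  by apply: nXa; exists b.
have : star E (fun a c => exists2 b, g a b & True) x x.
  by apply: star_sub xX => a _ [b ab]; exists b.
move=> /(star_comp E g (fun _ _ => True))[y xy _]; exists y => //.
by apply: ue_lift_functional inj_g _ xv; exact: star_ue_lift.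
Qed.

Definition linked x y : Prop := exists2 g, partial_injection g & star E g x y.

Lemma linked_refl x : linked x x.
Proof. by exists eq; [exact: partial_injection_eq|exact/star_eq]. Qed.

Lemma linked_sym x y : linked x y -> linked y x.
Proof.
move=> [g inj_g xy]; exists (fun a b => g b a); last exact/star_conv.
exact: partial_injection_conv.
Qed.

Lemma linked_trans x y z : linked x y -> linked y z -> linked x z.
Proof.
move=> [g inj_g xy] [g' inj_g' yz].
exists (fun a c => exists2 b, g a b & g' b c).
  exact: partial_injection_comp.
by apply/star_comp; exists y.
Qed.

(** If [x] and [y] have the same type [u] then [g] maps [u] to itself. By
    Katetov's theorem [g] is the identity on a set that belongs to the type of
    [x]. *)
Lemma linked_type_inj x y : linked x y -> type_of x = type_of y -> x = y.
Proof.
move=> [g inj_g xy] txy.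
have := star_ue_lift xy; rewrite -txy => /(fixed_points_ultra inj_g) fixx.
have /starI : star E g x y /\ star E (fun a _ => g a a) x y.
  by split=> //; exact: star_row fixx.
move=> gfix; apply/(star_eq E).
by apply: star_sub gfix => a b [ab /inj_g.1]; apply.
Qed.

Lemma linked_transfer x y x' : linked x y -> type_of x = type_of x' ->
  exists2 y', linked x' y' & type_of y = type_of y'.
Proof.
move=> [g inj_g xy] txx'; have := star_ue_lift xy; rewrite txx'.
by move=> /(star_step inj_g)[y' xy' ty']; exists y' => //; exists g.
Qed.

(** The second clause says that the image of [h] is closed under linking; an
    element linked to it has then to be the chosen realization of its type. *)
Definition coherent_section (h : Uf A -> M) : Prop :=
  (forall u, type_of (h u) = u) /\
  (forall u y, linked (h u) y -> y = h (type_of y)).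

(** For a partial injection [g] mapping [u] to [v], the image of [h u] under the
    extension of [g] has type [v] and is linked to [h u], so it is [h v]. *)
Lemma coherent_section_star h S u v : coherent_section h -> tame S ->
  star E S (h u) (h v) <-> ue_lift S u v.
Proof.
move=> [th hlink] tS; split=> [/star_ue_lift|]; first by rewrite !th.
elim: tS => {S} [g inj_g uv|X Y /ue_lift_rect|S S' _ IH _ IH' /ue_liftU[]].
- have [|y uy ty] := @star_step g (h u) v inj_g; first by rewrite th.
  by rewrite -ty -(hlink u) //; exists g.
- by move=> uv; apply/star_rect; rewrite !th.
- by move/IH=> uv; apply/starU; left.
- by move/IH'=> uv; apply/starU; right.
Qed.

(** Call [u] and [v] equivalent when a partial injection maps [u] to [v]. One
    base point is chosen in each class and realized arbitrarily; every other
    [u] in the class then has exactly one realization linked to that of the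
    base point. *)
Lemma coherent_section_exists : (forall u, exists x, type_of x = u) ->
  exists h, coherent_section h.
Proof.
move=> /choice[r rP].
pose link u : pred {classic Uf A} := fun v =>
  `[< exists2 g, partial_injection g & ue_lift g u v >].
have linkP u : exists v : {classic Uf A}, link u v.
  by exists u; apply/asboolP; exists eq;
    [exact: partial_injection_eq|exact: ue_lift_eq].
pose base u : Uf A := xchoose (linkP u).
have baseP u : exists y, linked (r (base u)) y /\ type_of y = u.
  have /asboolP[g inj_g ub] : link u (base u) by exact: xchooseP.
  have [|y y1 y2] := @star_step _ (r (base u)) u (partial_injection_conv inj_g).
    by rewrite rP; exact: ue_lift_conv.
  by exists y; split=> //; exists (fun a b => g b a) => //;
    exact: partial_injection_conv.
have [h hP] := choice baseP.
exists h; split=> [u|u y uy]; first by have [] := hP u.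
have uty : base u = base (type_of y).
  (* [xchoose] depends only on the extension of the predicate. *)
  apply: (@eq_xchoose _ (link u) (link (type_of y))) => w.
  apply: asbool_equiv_eq.
  have [_ hu] := hP u; move: uy => [g inj_g /star_ue_lift]; rewrite hu => uy.
  have inj_gc := partial_injection_conv inj_g.
  split=> -[g' inj_g' uw].
    exists (fun a c => exists2 b, g b a & g' b c).
      exact: partial_injection_comp.
    by apply: ue_lift_comp uw; exact: ue_lift_conv.
  exists (fun a c => exists2 b, g a b & g' b c).
    exact: partial_injection_comp.
  exact: ue_lift_comp uw.
have [yy ty] := hP (type_of y).
apply: linked_type_inj; last by rewrite ty.
apply: linked_trans yy; rewrite -uty.
by apply: linked_sym; apply: linked_trans uy; have [] := hP u.
Qed.

End Extensions.

(** * Satisfaction and automorphisms *)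

Lemma extend_comp (M N : Type) (h : M -> N) n (a : M) (e : 'I_n -> M) :
  h \o extend a e = extend (h a) (h \o e).
Proof. by apply/funext=> i; rewrite /extend /=; case: unlift. Qed.

(** Isomorphisms given by their graph, which spares the definition by cases of
    the automorphism that exchanges two classes. *)
Lemma sat_correspondence (M N : structure) (Z : M -> N -> Prop) :
  (forall x, exists y, Z x y) -> (forall y, exists x, Z x y) ->
  (forall x y x' y', Z x y -> Z x' y' -> (x = x' <-> y = y')) ->
  (forall x y x' y', Z x y -> Z x' y' -> (edge x x' <-> edge y y')) ->
  forall n (phi : formula n) e e', (forall i, Z (e i) (e' i)) ->
  sat phi e <-> sat phi e'.
Proof.
move=> Zl Zr Zeq Zedge n phi; elim: phi => {n}
  [n i j|n i j|n|n phi IHp psi IHq|n phi IH] e e' ee' /=.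
- exact: Zeq.
- exact: Zedge.
- by [].
- by rewrite (IHp _ _ ee') (IHq _ _ ee').
- have ext a b : Z a b -> forall i, Z (extend a e i) (extend b e' i).
    by move=> ab i; rewrite /extend; case: unlift.
  split=> H a.
  + by have [b ba] := Zr a; apply/(IH _ _ (ext _ _ ba)).
  + by have [b ab] := Zl a; apply/(IH _ _ (ext _ _ ab)).
Qed.

Section Swap.
Variables (A : Type) (M : structure) (E : extension A M).
Variables (b b' : M).
Hypothesis tbb' : type_of E b = type_of E b'.
Hypothesis nbb' : ~ linked E b b'.
Hypothesis edge_tame :
  exists2 S, tame S & forall x y : M, edge x y <-> star E S x y.

Let swap x x' : Prop := type_of E x = type_of E x' /\
  [\/ linked E b x /\ linked E b' x', linked E b' x /\ linked E b x' |
      [/\ ~ linked E b x, ~ linked E b' x & x = x']].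

Let swap_sym x x' : swap x x' -> swap x' x.
Proof.
move=> [txx' c]; split=> //.
by case: c => [[? ?]|[? ?]|[? ? <-]];
  [apply: Or32|apply: Or31|apply: Or33].
Qed.

Let swap_total x : exists x', swap x x'.
Proof.
have [bx|nbx] := pselect (linked E b x).
  have [x' bx' txx'] := linked_transfer bx tbb'.
  by exists x'; split=> //; apply: Or31.
have [b'x|nb'x] := pselect (linked E b' x).
  have [x' bx' txx'] := linked_transfer b'x (esym tbb').
  by exists x'; split=> //; apply: Or32.
by exists x; split=> //; apply: Or33.
Qed.

Let apart x : linked E b x -> linked E b' x -> False.
Proof.
by move=> bx b'x; apply: nbb'; exact: linked_trans bx (linked_sym b'x).
Qed.

Let swap_fun x y y' : swap x y -> swap x y' -> y = y'.
Proof.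
move=> [xy cy] [xy' cy'].
have inj c : linked E c y -> linked E c y' -> y = y'.
  move=> cy1 cy2.
  by apply: linked_type_inj (linked_trans (linked_sym cy1) cy2) _; rewrite -xy.
case: cy => [[bx b'y]|[b'x b'y]|[nbx nb'x <-]];
  case: cy' => [[bx' b'y']|[b'x' b'y']|[nbx' nb'x' e]] //.
- exact: (inj b').
- by case: (@apart x).
- by case: (@apart x).
- exact: (inj b).
Qed.

Let swap_star S x y x' y' : tame S -> swap x x' -> swap y y' ->
  star E S x y -> star E S x' y'.
Proof.
move=> tS xx' yy'; elim: tS => {S} [g inj_g xy|X Y|S S' _ IH _ IH'].
- have [txx' cx] := xx'.
  have := star_ue_lift xy; rewrite txx' => /(star_step inj_g)[z x'z tz].
  suff /(swap_fun yy') -> : swap y z by [].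
  split=> //.
  have lxy : linked E x y by exists g.
  have lx'z : linked E x' z by exists g.
  case: cx => [[bx b'x']|[b'x bx']|[nbx nb'x xe]].
  + by apply: Or31; split; apply: linked_trans; eassumption.
  + by apply: Or32; split; apply: linked_trans; eassumption.
  + have lyx := linked_sym lxy.
    apply: Or33; split.
    * by move=> by_; apply: nbx; exact: linked_trans by_ lyx.
    * by move=> b'y; apply: nb'x; exact: linked_trans b'y lyx.
    apply: (linked_type_inj _ (esym tz)).
    by apply: linked_trans lyx _; rewrite xe.
- by move=> /star_rect; rewrite xx'.1 yy'.1 => /star_rect.
- by case/starU=> [/IH|/IH'] ?; apply/starU; [left|right].
Qed.

(** The map that exchanges the linking classes of [b] and [b'], matching
    elements of the same type, and fixes everything else is an automorphism.
    It respects rectangles because it preserves types, and partial injections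
    because their edges stay within one class. *)
Lemma sat_swap n (phi : formula n.+1) (e : 'I_n -> M) :
  (forall i, ~ linked E b (e i)) -> (forall i, ~ linked E b' (e i)) ->
  sat phi (extend b e) <-> sat phi (extend b' e).
Proof.
move=> nbe nb'e; apply: (@sat_correspondence _ _ swap).
- exact: swap_total.
- by move=> y; have [x yx] := swap_total y; exists x; exact: swap_sym.
- move=> x y x' y' xy xy'; split=> xe.
    by move: xy'; rewrite -xe; exact: swap_fun.
  by move: xy xy' => /swap_sym + /swap_sym; rewrite xe; exact: swap_fun.
- have [S tS edgeE] := edge_tame.
  move=> x y x' y' xy xy'; rewrite !edgeE; split; first exact: swap_star.
  by apply: swap_star => //; exact: swap_sym.
- move=> i; rewrite /extend; case: unlift => [j|].
    by split=> //; apply: Or33.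
  by split=> //; apply: Or31; split; exact: linked_refl.
Qed.

End Swap.

(** * Ultrapowers *)

Section UltrapowerTheory.
Variables (I : Type) (D : Uf I) (M : structure).

Definition coord (x : ultrapower D M) : I -> M := repr x.

Definition class_of (f : I -> M) : ultrapower D M :=
  \pi_{eq_quot (eq_mod_equiv D M)}%qT (f : {classic I -> M}).

Lemma coord_class_of f : sval D [set i | coord (class_of f) i = f i].
Proof.
have /eqmodP/asboolP :
    repr (class_of f) = f %[mod {eq_quot (eq_mod_equiv D M)}].
  by rewrite reprK.
by [].
Qed.

Lemma ultrapower_eq (x y : ultrapower D M) :
  x = y <-> sval D [set i | coord x i = coord y i].
Proof.
split=> [->|xy]; first by apply: (filterS _ filterT) => i _.
rewrite -[x]reprK -[y]reprK; apply/eqmodP; exact/asboolP.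
Qed.

(** The existential step of Los's theorem, which also shows that ultrapowers
    preserve composition of relations. *)
Lemma ultrapower_choice (P : I -> M -> Prop) :
  sval D [set i | exists a, P i a] ->
  exists x, sval D [set i | P i (coord x i)].
Proof.
move=> DP; have [i0 [a0 _]] := filter_ex DP.
have /choice[f fP] : forall i, exists a, (exists a, P i a) -> P i a.
  move=> i; have [[a ia]|?] := pselect (exists a, P i a); first by exists a.
  by exists a0.
exists (class_of f); apply: filterS2 DP (coord_class_of f) => i /= /fP Pi.
by move=> ->.
Qed.

(** Los's theorem. *)
Lemma ultrapower_sat n (phi : formula n) (e : 'I_n -> ultrapower D M) :
  sat phi e <-> sval D [set i | sat phi (fun k => coord (e k) i)].
Proof.
elim: phi e => {n} [n j k|n j k|n|n phi IHp psi IHq|n phi IH] e /=.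
- exact: ultrapower_eq.
- by [].
- by split=> // /filter_ex[].
- rewrite IHp IHq; split=> [pq|]; last first.
    by move=> pq p; apply: filterS2 pq p => i /= h; exact: h.
  case: (in_ultra_setVsetC [set i | sat phi (fun k => coord (e k) i)]
    (Uf_ultra D)).
    by move=> /pq; apply: filterS => i ? ?.
  by apply: filterS => i np /np.
- have ext a i : (fun k => coord (extend a e k) i) =
      extend (coord a i) (fun k => coord (e k) i).
    exact: (extend_comp (fun x => coord x i) a e).
  split=> [all_phi|]; last first.
    by move=> all_phi a; apply/IH; apply: filterS all_phi => i /=; rewrite ext.
  apply: contrapT => /uf_setC nD.
  have [|x xP] := @ultrapower_choice
    (fun i a => ~ sat phi (extend a (fun k => coord (e k) i))).
    by apply: filterS nD => i /existsNP.
  have /IH xP' := all_phi x.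
  by have [i [/=]] := uf_meet xP xP'; rewrite ext.
Qed.

Definition diag (a : M) : ultrapower D M := class_of (fun=> a).

Lemma ultrapower_sat_class n (phi : formula n) (f : 'I_n -> I -> M) :
  sat phi (fun k => class_of (f k)) <->
  sval D [set i | sat phi (fun k => f k i)].
Proof.
rewrite ultrapower_sat.
pose good k : set I := [set i | coord (class_of (f k)) i = f k i].
have Dgood : sval D (\bigcap_(X in good @` [set: 'I_n]) X).
  apply: uf_bigcap; first exact: finite_image finite_finset.
  by move=> _ [k _ <-]; exact: coord_class_of.
have goodE i : (\bigcap_(X in good @` [set: 'I_n]) X) i ->
    (fun k => coord (class_of (f k)) i) = (fun k => f k i).
  by move=> H; apply/funext => k; apply: (H (good k)); exists k.
by split; apply: filterS2 Dgood => i /goodE /= ->.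
Qed.

Lemma diag_elementary : elementary_embedding diag.
Proof.
move=> n phi e; rewrite (ultrapower_sat_class phi (fun k _ => e k)).
by split=> [phie|/filter_ex[]//]; apply: (filterS _ filterT).
Qed.

Lemma class_of_sub (S : M -> M -> Prop) f g :
  sval D [set i | S (f i) (g i)] <->
  sval D [set i | S (coord (class_of f) i) (coord (class_of g) i)].
Proof.
by split; apply: filterS3 (coord_class_of f) (coord_class_of g) => i /= -> ->.
Qed.

Variable (A : Type) (E : extension A M).

Let ustar S (x y : ultrapower D M) : Prop :=
  sval D [set i | star E S (coord x i) (coord y i)].

Let ustarI S S' x y :
  ustar (fun a b => S a b /\ S' a b) x y <-> ustar S x y /\ ustar S' x y.
Proof.
split=> [xy|[xy xy']].
  by split; apply: filterS xy => i /starI[].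
by apply: filterS2 xy xy' => i ? ?; apply/starI.
Qed.

Let ustarN S x y : ustar (fun a b => ~ S a b) x y <-> ~ ustar S x y.
Proof. by rewrite -uf_setC; split; apply: filterS => i /starN. Qed.

Let ustar_eq x y : ustar eq x y <-> x = y.
Proof.
by rewrite ultrapower_eq; split; apply: filterS => i; rewrite /= star_eq.
Qed.

Let ustar_conv S x y : ustar (fun a b => S b a) x y <-> ustar S y x.
Proof. by split; apply: filterS => i; rewrite /= star_conv. Qed.

Let ustar_comp S S' x z :
  ustar (fun a c => exists2 b, S a b & S' b c) x z <->
  exists2 y, ustar S x y & ustar S' y z.
Proof.
split=> [xz|[y xy yz]]; last first.
  by apply: filterS2 xy yz => i ? ?; apply/star_comp; exists (coord y i).
have [|y yP] := @ultrapower_choice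
  (fun i b => star E S (coord x i) b /\ star E S' b (coord z i)).
  by apply: filterS xz => i /star_comp[b]; exists b.
by exists y; apply: filterS yP => i [].
Qed.

Definition ultrapower_extension : extension A (ultrapower D M) :=
  Extension ustarI ustarN ustar_eq ustar_conv ustar_comp.

Lemma star_diag S x y :
  star ultrapower_extension S (diag x) (diag y) <-> star E S x y.
Proof.
rewrite /= /ustar -(class_of_sub (star E S) (fun=> x) (fun=> y)).
by split=> [/filter_ex[]//|xy]; apply: (filterS _ filterT).
Qed.

Lemma type_of_diag x : type_of ultrapower_extension (diag x) = type_of E x.
Proof. by apply: uf_ext => X /star_diag. Qed.

Lemma linked_diag x y :
  linked ultrapower_extension (diag x) (diag y) <-> linked E x y.
Proof.
by split=> -[g inj_g xy]; exists g => //; apply/star_diag.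
Qed.

End UltrapowerTheory.

(** * Elementarity of coherent sections *)

(** On [A], the rectangle of [w] with itself is contained in the equality. *)
Lemma type_of_principal_inj (A M : structure) (E : extension A M) w x y :
  type_of E x = principal w -> type_of E y = principal w -> x = y.
Proof.
move=> tx ty; have : star E (fun a b => [set w] a /\ [set w] b) x y.
  by apply/star_rect; rewrite tx ty; split; exact/principal_filterP.
by move=> xy; apply/(star_eq E); apply: star_sub xy => a b [-> ->].
Qed.

Definition id_extension (A : Type) : extension A A :=
  @Extension A A id (fun _ _ _ _ => iff_refl _) (fun _ _ _ => iff_refl _)
    (fun _ _ => iff_refl _) (fun _ _ _ => iff_refl _)
    (fun _ _ _ _ => iff_refl _).

Lemma type_of_id (A : structure) (w : A) :
  type_of (id_extension A) w = principal w.
Proof. by apply: uf_ext => X Xw; exact/principal_filterP. Qed.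

Section Elementary.
Variables (A M : structure) (E : extension A M).
Hypothesis edgeE : forall x y : M, edge x y <-> star E (@edge A) x y.
Hypothesis tame_edge : tame (@edge A).
Variable h : Uf A -> M.
Hypothesis hP : coherent_section E h.

Let th u : type_of E (h u) = u := hP.1 u.

(** The Tarski-Vaught condition for the image of [h]. Realizing the type [u] of
    [b] by a second element [b'] requires no saturation: the ultrapower modulo
    [u] itself, with index set [A], contains such an element. *)
Lemma coherent_section_witness n (phi : formula n.+1) (v : 'I_n -> Uf A)
    (b : M) :
  (forall u, sat phi (extend (h u) (h \o v))) -> sat phi (extend b (h \o v)).
Proof.
move=> hphi; apply: contrapT => nphib.
pose u := type_of E b.
have nbh : b <> h u.
  by move=> bh; apply: nphib; rewrite bh.
pose E' := ultrapower_extension u E.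
pose d := @diag _ u M.
pose b' : ultrapower u M := class_of u (fun w => h (principal w)).
have tb' : type_of E' b' = u.
  apply/esym/uf_ext => X uX.
  apply: (class_of_sub _ (star E (fun a _ => X a)) _ _).1.
  apply: filterS uX => w Xw.
  suff : sval (type_of E (h (principal w))) X by [].
  by rewrite th; exact/principal_filterP.
have tb : type_of E' (d b) = u by exact: type_of_diag.
have phib' : sat phi (extend b' (d \o (h \o v))).
  rewrite (_ : extend _ _ = fun k => class_of u
    (extend (fun w => h (principal w)) (fun k _ => h (v k)) k)); last first.
    exact: (esym (extend_comp (@class_of _ u M) _ _)).
  apply/ultrapower_sat_class; apply: (filterS _ filterT) => w _.
  have evalE :
      (fun k => extend (fun w => h (principal w)) (fun k _ => h (v k)) k w) =
      extend (h (principal w)) (h \o v).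
    exact: (extend_comp (fun f : A -> M => f w) (fun w => h (principal w))
      (fun k _ => h (v k))).
  by rewrite /= evalE.
have nphidb : ~ sat phi (extend (d b) (d \o (h \o v))).
  by move=> phidb; apply/nphib/(diag_elementary u); rewrite extend_comp.
have nlink : ~ linked E' (d b) b'.
  move=> lbb'; have bb' := linked_type_inj lbb' (etrans tb (esym tb')).
  by rewrite bb' in nphidb.
have tame_edge' : exists2 S, tame S & forall x y, edge x y <-> star E' S x y.
  exists (@edge A) => // x y.
  by split; apply: filterS => i; rewrite /= edgeE.
apply: nphidb; apply/(sat_swap _ nlink tame_edge') => //.
- by rewrite tb tb'.
- move=> i bv; have vb := linked_sym ((linked_diag _ _ _ _).1 bv).
  by apply: nbh; exact: hP.2 _ _ vb.
- (* If [b'] were linked to a parameter then [b'] would be the diagonal image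
     of [h u], so [h u] would equal [h (principal w)] for some [w] and [u] would
     be principal. But then [b] would be [h u]. *)
  move=> i b'v.
  have [y vy ty] : exists2 y, linked E (h (v i)) y & type_of E y = u.
    have [g inj_g vb'] := linked_sym b'v.
    have := star_ue_lift vb'; rewrite tb' type_of_diag.
    by move=> /(star_step inj_g)[y vy ty]; exists y => //; exists g.
  have yE : y = h u by rewrite -ty; exact: (hP.2 _ _ vy).
  have b'E : b' = d (h u).
    apply: (@linked_type_inj _ _ E').
      by apply: linked_trans b'v _; apply/linked_diag; rewrite -yE.
    by rewrite tb' type_of_diag th.
  have [w hw] : exists w, h (principal w) = h u.
    apply: (@filter_ex _ (sval u)).
    by apply: (class_of_sub u eq _ _).2; apply/ultrapower_eq.
  have uw : u = principal w by rewrite -(th u) -hw th.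
  by apply: nbh; apply: (@type_of_principal_inj _ _ E w); rewrite ?th.
Qed.

Lemma coherent_section_elementary : elementary_embedding (h : ue A -> M).
Proof.
move=> n; elim=> {n} [n i j|n i j|n|n phi IHp psi IHq|n phi IH] v /=.
- by split=> [->//|/(congr1 (type_of E))]; rewrite !th.
- by rewrite edgeE (coherent_section_star _ _ hP tame_edge); exact: edge_ue.
- by [].
- by rewrite IHp IHq.
- split=> [all_phi b|all_phi u].
    by apply: coherent_section_witness => u; rewrite -extend_comp; exact/IH.
  by apply/IH; rewrite extend_comp.
Qed.

End Elementary.

(** Regularity gives, for each subset [X] of [A], a set [f X] of the ultrafilter
    such that every index [i] lies in only finitely many [f X]. So for each [i]
    some [a i] belongs to all [X] in [u] with [i] in [f X], and [a] takes values
    in [X] on all of [f X]. *)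
Lemma regular_realizes (A : structure) (K I : Type) (D : Uf I) :
  [set: set A] #<= [set: K] -> regular_ultrafilter K D ->
  forall u, exists x, type_of (ultrapower_extension D (id_extension A)) x = u.
Proof.
move=> AK [F [FD FK finF]] u.
have /pcard_leP/unsquash f : [set: set A] #<= F by rewrite (card_le_eqr FK).
have fF X : F (f X) by exact: (@funS _ _ _ _ f).
have f_inj X Y : f X = f Y -> X = Y by apply: inj; rewrite inE.
have /choice[a aP] i : exists a, forall X, sval u X -> f X i -> X a.
  have fini : finite_set [set X | sval u X /\ f X i].
    have finj : {in f @^-1` (F `&` [set Y | Y i]) &, injective f}.
      by move=> X Y _ _; exact: f_inj.
    have /(finite_preimage finj) : finite_set (F `&` [set Y | Y i]).
      exact: finF.
    by apply: sub_finite_set => X [uX Xi]; split.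
  have /filter_ex[a aX] : sval u (\bigcap_(X in [set X | sval u X /\ f X i]) X).
    by apply: uf_bigcap => // X [].
  by exists a => X uX Xi; exact: aX.
exists (class_of D a); apply/esym/uf_ext => X uX.
apply: (class_of_sub D (fun a _ => X a) a a).1.
by apply: filterS (FD _ (fF X)) => i; exact: aP.
Qed.

Theorem theorem2p11 (A : structure) (K I : Type) (D : Uf I) :
  almost_bounded A ->
  infinite_set [set: I] ->
  [set: set A] #<= [set: K] ->
  regular_ultrafilter K D ->
  elementary_embedding (@principal A) /\
  exists h : ue A -> ultrapower D A, elementary_embedding h.
Proof.
move=> /almost_bounded_tame tame_edge _ AK regD.
pose E := ultrapower_extension D (id_extension A).
have [h hP] := coherent_section_exists (regular_realizes AK regD).
have h_elem : elementary_embedding (h : ue A -> ultrapower D A).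
  exact: (@coherent_section_elementary _ _ E).
split; last by exists h.
move=> n phi e; rewrite h_elem (diag_elementary D phi e).
suff -> : @diag I D A \o e = h \o (@principal A \o e) by [].
apply/funext => i; apply: (@type_of_principal_inj _ _ E (e i)).
  by rewrite type_of_diag type_of_id.
exact: hP.1.
Qed.
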